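(* Let $N=(A,\mathfrak{C})$ be a regular oriented matroid. There exists a unique polynomial $\mathcal{A}_N(q,y,z)\in\mathbb{Q}[q,y,z]$ such that for every odd positive integer $q$, \[\mathcal{A}_N(q,y,z)=\sum_{f\in F_N(q)} y^{|f_A^>|}z^{|f_A^<|}.\]
   Context: An oriented matroid $N=(A,\mathfrak{C})$ has finite ground set $A$ and set of signed circuits $\mathfrak{C}$; each signed circuit is a pair $C=(C^+,C^-)$ of disjoint subsets of $A$. $N$ is regular if it is representable over $\mathbb{R}$ by a totally unimodular matrix. For a positive integer $q$, a $q$-coflow of $N$ is a map $f:A\to\mathbb{Z}/q\mathbb{Z}$ such that $\sum_{a\in C^+}f(a)-\sum_{a\in C^-}f(a)=0$ in $\mathbb{Z}/q\mathbb{Z}$ for every signed circuit $C\in\mathfrak{C}$; $F_N(q)$ denotes the set of $q$-coflows. For $x\in\mathbb{Z}/q\mathbb{Z}$ and a set of integers $S$, ''$x\in S$'' means $x=s+q\mathbb{Z}$ for some $s\in S$. Define $f_A^>=\{a\in A: f(a)\in\{1,2,\ldots,\lfloor q/2\rfloor\}\}$ and $f_A^<=\{a\in A: -f(a)\in\{1,2,\ldots,\lfloor q/2\rfloor\}\}$. *)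

(* Defs.v *)
(* [R : realType] stands for the field of real numbers. *)
From HB Require Import structures.
From mathcomp Require Import all_boot all_order all_algebra.
From mathcomp Require Import reals.
From mathcomp Require Import mpoly.

Set Implicit Arguments.
Unset Strict Implicit.
Unset Printing Implicit Defensive.
Import Order.TTheory GRing.Theory Num.Theory.

Local Open Scope ring_scope.

(* A pair (X^+, X^-); disjointness of the two parts is imposed separately. *)
Definition signed_set (A : finType) : finType := ({set A} * {set A})%type.

Section SignedSets.
Variable A : finType.
Implicit Types X Y : signed_set A.

Definition spos X : {set A} := X.1.
Definition sneg X : {set A} := X.2.
Definition sopp X : signed_set A := (sneg X, spos X).
Definition ssupp X : {set A} := spos X :|: sneg X.

End SignedSets.

(* The signed circuit axioms; the ground set is the whole of [A]. *)
Record oriented_matroid (A : finType) := OrientedMatroid {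
  circuits : {set signed_set A};
  circuit_disjoint : forall X, X \in circuits -> [disjoint spos X & sneg X];
  circuit_nonempty : (set0, set0) \notin circuits;
  circuit_sopp : forall X, X \in circuits -> sopp X \in circuits;
  circuit_incomparable : forall X Y, X \in circuits -> Y \in circuits ->
    ssupp X \subset ssupp Y -> X = Y \/ X = sopp Y;
  circuit_elimination : forall X Y e, X \in circuits -> Y \in circuits ->
    X <> sopp Y -> e \in spos X :&: sneg Y ->
    exists Z, [/\ Z \in circuits,
      spos Z \subset (spos X :|: spos Y) :\ e &
      sneg Z \subset (sneg X :|: sneg Y) :\ e]
}.

Definition totally_unimodular (R : realType) m n (M : 'M[R]_(m, n)) : Prop :=
  forall k (f : 'I_k -> 'I_m) (g : 'I_k -> 'I_n),
    injective f -> injective g ->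
    \det (mxsub f g M) \in [:: 0; 1; -1].

Section Representation.
Variables (R : realType) (A : finType).

(* Vectors in R^A are column vectors whose entry of index [enum_rank a]
   belongs to [a]. *)
Definition vpos (x : 'cV[R]_#|A|) : {set A} :=
  [set a | 0 < x (enum_rank a) 0].
Definition vneg (x : 'cV[R]_#|A|) : {set A} :=
  [set a | x (enum_rank a) 0 < 0].
Definition vsupp (x : 'cV[R]_#|A|) : {set A} :=
  [set a | x (enum_rank a) 0 != 0].

(* [C] is the sign pattern of a minimal linear dependence among the columns
   of [M]. *)
Definition mx_circuit m (M : 'M[R]_(m, #|A|)) (C : signed_set A) : Prop :=
  exists x : 'cV[R]_#|A|,
    [/\ M *m x = 0, x != 0,
        (forall y : 'cV[R]_#|A|, M *m y = 0 -> y != 0 ->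
           vsupp y \subset vsupp x -> vsupp y = vsupp x)
      & C = (vpos x, vneg x)].

Definition represents m (M : 'M[R]_(m, #|A|)) (N : oriented_matroid A) : Prop :=
  forall C, C \in circuits N <-> mx_circuit M C.

End Representation.

Definition regular (R : realType) (A : finType) (N : oriented_matroid A) : Prop :=
  exists m (M : 'M[R]_(m, #|A|)), totally_unimodular M /\ represents M N.

(* For q > 0 this is Z/qZ with its canonical additive group structure.
   'Z_q is not suitable, since 'Z_1 has two elements. *)
Notation Zmod q := 'I_(q.-1.+1).

Section Coflows.
Variables (A : finType) (N : oriented_matroid A) (q : nat).
Implicit Type f : {ffun A -> Zmod q}.

Definition coflows : {set {ffun A -> Zmod q}} :=
  [set f : {ffun A -> Zmod q} | [forall C in circuits N,
     \sum_(a in spos C) f a - \sum_(a in sneg C) f a == 0]].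

(* The classes modulo q of 1, 2, ..., floor(q/2). *)
Definition lower_half : seq (Zmod q) := [seq inZp s | s <- iota 1 q./2].

Definition fgt f : {set A} := [set a | f a \in lower_half].
Definition flt f : {set A} := [set a | - f a \in lower_half].

End Coflows.

(* In {mpoly rat[3]} the variables q, y, z have indices 0, 1, 2. *)
Definition Yvar : {mpoly rat[3]} := 'X_(inord 1).
Definition Zvar : {mpoly rat[3]} := 'X_(inord 2).

(* P(n, y, z): only the variable q is replaced by a number. *)
Definition specialize_q (P : {mpoly rat[3]}) (n : nat) : {mpoly rat[3]} :=
  P \mPo [tuple n%:R; Yvar; Zvar].

(* Main.v *)
(* Let q be odd. The coflow f lies in the class > (resp. <) at a iff the residue
   x(a) of 2 f(a) in [0, q - 1] is even and nonzero (resp. odd). The integer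
   vector x satisfies <C, x> = q kappa(C) for every signed circuit C, with kappa
   bounded. So the sum is a combination of numbers of lattice points x of
   prescribed parity on faces of the dilates by q of the polytopes
   {0 <= x <= 1, <C, x> = kappa(C)}.
   Total unimodularity gives each nonempty such face a 0/1 point w. Translation
   by w embeds the (q - 1)-st dilate into the q-th one, changing the parity
   vector by w; by inclusion-exclusion the points missed are counted by proper
   faces. Hence, by induction on the dimension, F(q + 2) - F(q) is a
   quasi-polynomial of period 2 for each counting function F, and so is F. *)

Require Import Defs.
From mathcomp Require Import all_boot all_order all_algebra.
From mathcomp Require Import reals.
From mathcomp Require Import mpoly.
From mathcomp Require Import ring lra zify.

From Stdlib Require Import Classical.

Set Implicit Arguments.
Unset Strict Implicit.
Unset Printing Implicit Defensive.
Import Order.TTheory GRing.Theory Num.Theory.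

Local Open Scope ring_scope.

(** * Quasi-polynomials of period 2 *)

(** The difference of [x ^+ n.+1] is [2(n+1) x ^+ n] plus lower terms [c i * x ^+ i]; strong
    induction supplies a [T] that cancels them. *)
Lemma poly_antidiff2 (P : {poly rat}) :
  exists Q : {poly rat}, forall x, Q.[x + 2] - Q.[x] = P.[x].
Proof.
have mono n : exists Q : {poly rat}, forall x, Q.[x + 2] - Q.[x] = x ^+ n.
  elim/ltn_ind: n => n IH.
  pose c (i : 'I_n) : rat := 2 ^+ (n.+1 - i) *+ 'C(n.+1, i).
  have [T HT] : exists T : {poly rat},
      forall x, T.[x + 2] - T.[x] = \sum_(i < n) c i * x ^+ i.
    have /fin_all_exists [T HT] (i : 'I_n) := IH i (ltn_ord i).
    exists (\sum_(i < n) (c i)%:P * T i) => x.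
    rewrite !horner_sum -sumrB; apply: eq_bigr => i _.
    by rewrite !hornerM !hornerC -mulrBr HT.
  exists ((n.+1.*2%:R^-1)%:P * ('X^(n.+1) - T)) => x.
  rewrite !hornerM !hornerC !hornerD !hornerN !hornerXn.
  have -> : (x + 2) ^+ n.+1 =
      x ^+ n.+1 + n.+1.*2%:R * x ^+ n + \sum_(i < n) c i * x ^+ i.
    rewrite addrC exprDn big_ord_recr big_ord_recr /= !binn subnn mulr1n.
    rewrite expr0 mul1r subSnn expr1 binSn -mulr_natl -mul2n natrM.
    under eq_bigr => i _ do rewrite -mulrnAl -[_ *+ _]/(c i).
    by ring.
  have n0 : n.+1.*2%:R != 0 :> rat by rewrite pnatr_eq0.
  move: (HT x); set s := \sum_(_ < _) _ => E.
  by apply: (mulfI n0); rewrite mulrBr !mulVKf // -E; ring.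
have /fin_all_exists [Q HQ] (i : 'I_(size P)) := mono i.
exists (\sum_(i < size P) P`_i *: Q i) => x.
rewrite !horner_sum -sumrB horner_coef; apply: eq_bigr => i _.
by rewrite !hornerZ -mulrBr HQ.
Qed.

(** The value at 0 is left free: the equations of an empty polytope are still solved by the origin
    when [q = 0]. *)
Definition quasi_poly (F : nat -> rat) := exists P : bool -> {poly rat},
  forall q, (0 < q)%N -> F q = (P (odd q)).[q%:R].

Lemma eq_quasi_poly (F G : nat -> rat) :
  (forall q, (0 < q)%N -> F q = G q) -> quasi_poly F -> quasi_poly G.
Proof. by move=> FG [P HP]; exists P => q q0; rewrite -FG // HP. Qed.

Lemma quasi_poly0 : quasi_poly (fun=> 0).
Proof. by exists (fun=> 0) => q _; rewrite horner0. Qed.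

Lemma quasi_polyD (F G : nat -> rat) :
  quasi_poly F -> quasi_poly G -> quasi_poly (fun q => F q + G q).
Proof.
move=> [P HP] [Q HQ]; exists (fun b => P b + Q b) => q q0.
by rewrite hornerD HP ?HQ.
Qed.

Lemma quasi_polyM c (F : nat -> rat) : quasi_poly F -> quasi_poly (fun q => c * F q).
Proof.
by move=> [P HP]; exists (fun b => c *: P b) => q q0; rewrite hornerZ HP.
Qed.

Lemma quasi_poly_sum (I : finType) (S : pred I) (F : I -> nat -> rat) :
  (forall i, S i -> quasi_poly (F i)) ->
  quasi_poly (fun q => \sum_(i | S i) F i q).
Proof.
move=> HF; have /fin_all_exists [P HP] i : exists P : bool -> {poly rat},
    S i -> forall q, (0 < q)%N -> F i q = (P (odd q)).[q%:R].
  by case: (boolP (S i)) => [/HF[P HP]|]; [exists P | exists (fun=> 0)].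
exists (fun b => \sum_(i | S i) P i b) => q q0.
by rewrite horner_sum; apply: eq_bigr => i Si; rewrite HP.
Qed.

Lemma quasi_poly_shift F : quasi_poly F -> quasi_poly (fun q => F q.+1).
Proof.
move=> [P HP]; exists (fun b => P (~~ b) \Po ('X + 1)) => q _.
by rewrite horner_comp !hornerE HP //= natr1.
Qed.

Lemma quasi_poly_antidiff (F : nat -> rat) :
  quasi_poly (fun q => F q.+2 - F q) -> quasi_poly F.
Proof.
move=> [P HP].
have [Q1 HQ1] := poly_antidiff2 (P true); have [Q0 HQ0] := poly_antidiff2 (P false).
pose Q b := if b then Q1 else Q0.
have HQ b x : (Q b).[x + 2] - (Q b).[x] = (P b).[x] by case: b.
pose G q : rat := F q - (Q (odd q)).[q%:R].
have G2 q : (0 < q)%N -> G q.+2 = G q.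
  move=> q0; move: (HQ (odd q) q%:R); rewrite -HP // /G /= negbK.
  have -> : q.+2%:R = q%:R + 2 :> rat by rewrite -addn2 natrD.
  by move=> E; lra.
(* [G] is constant on each parity class of positive integers, with representatives 1 and 2. *)
exists (fun b => Q b + (if b then G 1%N else G 2)%:P) => q.
rewrite hornerD hornerC.
elim/ltn_ind: q => -[|[|[|q]]] // IH _; try by rewrite /G /=; ring.
have := IH q.+1 (leqnSn _) isT; have := G2 q.+1 isT; rewrite {1 2}/G /= !negbK.
by case: (odd q) => /=; move=> E1 E2; lra.
Qed.
(** * Elementary vectors of a totally unimodular matrix *)

Section Elementary.
Variables (R : realType) (m n : nat) (M : 'M[R]_(m, n)).
Implicit Types y z : 'cV[R]_n.

Definition supp y : {set 'I_n} := [set j | y j 0 != 0].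

Definition elementary y := [/\ M *m y = 0, y != 0 &
  forall z, M *m z = 0 -> z != 0 -> supp z \subset supp y -> supp z = supp y].

Lemma supp_eq0 y : supp y = set0 -> y = 0.
Proof.
move=> /setP y0; apply/colP => j; rewrite mxE; apply/eqP.
by move: (y0 j); rewrite !inE => /negbFE.
Qed.

(** A dependence among these columns would be a kernel vector supported inside [supp y] but missing
    [j0], against minimality. *)
Lemma elementary_row_full y j0 : elementary y -> j0 \in supp y ->
  row_full (colsub (enum_val : 'I_#|supp y :\ j0| -> 'I_n) M).
Proof.
move=> [My y0 miny] j0y; set K := supp y :\ j0; set g := enum_val.
rewrite /row_full -mxrank_tr -/(row_free _); apply: inj_row_free => v vB.
pose z : 'cV[R]_n := \col_i \sum_l (i == g l)%:R * v 0 l.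
have zg l : z (g l) 0 = v 0 l.
  rewrite mxE (bigD1 l) //= eqxx mul1r big1 ?addr0 // => l' /negPf ll'.
  by rewrite (inj_eq enum_val_inj) eq_sym ll' mul0r.
have zK i : i \notin K -> z i 0 = 0.
  move=> iK; rewrite mxE big1 // => l _.
  by case: eqP iK => [->|_]; rewrite ?enum_valP ?mul0r.
have Mz : M *m z = 0.
  apply/colP => i; rewrite !mxE (bigID (mem K)) /= [X in _ + X]big1 ?addr0; last first.
    by move=> j jK; rewrite zK ?mulr0.
  have vBi : (v *m (colsub g M)^T) 0 i = 0 by rewrite vB mxE.
  rewrite big_enum_val /= -[RHS]vBi mxE.
  by apply: eq_bigr => l _; rewrite zg !mxE mulrC.
have [z0|z0] := eqVneq z 0.
  by apply/rowP => l; rewrite -zg z0 !mxE.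
have sz : supp z \subset supp y.
  apply/subsetP => i; rewrite inE; apply: contraR => iy.
  by rewrite zK // !inE negb_and; rewrite inE in iy; rewrite iy orbT.
move: (miny z Mz z0 sz) => /setP /(_ j0); rewrite j0y inE zK ?eqxx //.
by rewrite !inE eqxx.
Qed.

(* By Cramer's rule the ratio of two entries is a ratio of two maximal minors. *)
Lemma elementary_norm y j j0 : totally_unimodular M -> elementary y ->
  j \in supp y -> j0 \in supp y -> `|y j 0| = `|y j0 0|.
Proof.
move=> TU Ey jy j0y; have [->//|jj0] := eqVneq j j0.
have full := elementary_row_full Ey j0y; case: Ey => My _ _.
set K := supp y :\ j0 in full; set g := enum_val in full.
pose f := fullrankfun full; pose B := mxsub f g M.
have detB : \det B != 0.
  have := fullrowsub_unit full; rewrite unitmxE unitfE.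
  by congr (\det _ != 0); apply/matrixP => a b; rewrite !mxE.
have jK : j \in K by rewrite in_setD1 jj0.
pose l0 := enum_rank_in jK j.
have gl0 : g l0 = j by rewrite /g /l0 enum_rankK_in.
(* Exchanging the column [j] for [j0] leaves the cofactors along [l0] unchanged. *)
pose g' l := if l == l0 then j0 else g l.
have g_neq l : g l != j0 by have := enum_valP l; rewrite !inE => /andP[].
have g'_inj : injective g'.
  move=> l l'; rewrite /g'; case: eqP => [->|_]; case: eqP => [->|_] //.
  - by move/eqP; rewrite eq_sym (negPf (g_neq _)).
  - by move/eqP; rewrite (negPf (g_neq _)).
  - exact: enum_val_inj.
have f_inj : injective f by exact: fullrankfun_inj.
have cofE i : cofactor (mxsub f g' M) i l0 = cofactor B i l0.
  rewrite /cofactor; congr (_ * \det _); apply/matrixP => a b; rewrite !mxE.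
  by rewrite /g' eq_sym (negPf (neq_lift _ _)).
have rowE i : y j0 0 * M (f i) j0 = - \sum_l y (g l) 0 * B i l.
  move/colP: My => /(_ (f i)); rewrite !mxE (bigD1 j0) //= => /eqP.
  rewrite addr_eq0 mulrC => /eqP ->; congr (- _).
  rewrite (bigID (mem K)) /= [X in _ + X]big1 ?addr0; last first.
    by move=> a /andP[aj0]; rewrite !inE aj0 /= negbK => /eqP ->; rewrite mulr0.
  rewrite (eq_bigl (mem K)); last first.
    by move=> a /=; rewrite !inE; case: eqP.
  by rewrite big_enum_val /=; apply: eq_bigr => l _; rewrite !mxE mulrC.
(* Expansion along [l0], the row equations [rowE] and the identity for [\adj B *m B] leave only the
   term of [j]. *)
have key : y j0 0 * \det (mxsub f g' M) = - (y j 0 * \det B).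
  rewrite (expand_det_col _ l0) mulr_sumr.
  under eq_bigr => i _ do rewrite cofE mxE /g' eqxx mulrA rowE mulNr mulr_suml.
  rewrite sumrN exchange_big /=; congr (- _).
  under eq_bigr => l _.
    under eq_bigr => i _ do rewrite -mulrA.
    rewrite -mulr_sumr.
    have -> : \sum_i B i l * cofactor B i l0 = (\adj B *m B) l0 l.
      by rewrite mxE; apply: eq_bigr => i _; rewrite [\adj B _ _]mxE mulrC.
    rewrite mul_adj_mx mxE. over.
  rewrite (bigD1 l0) //= big1 ?addr0 ?eqxx ?mulr1n ?gl0 // => l.
  by rewrite eq_sym => /negPf ->; rewrite mulr0n mulr0.
have detN k (C : 'M[R]_k) : \det C \in [:: 0; 1; -1] -> \det C != 0 -> `|\det C| = 1.
  by rewrite !inE => /or3P[]/eqP-> //; rewrite ?eqxx // ?normrN normr1.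
have g_inj : injective g by exact: enum_val_inj.
move/(congr1 Num.norm): (key); rewrite normrN !normrM (detN _ B) ?mulr1 //; last first.
  exact: TU.
rewrite detN ?mulr1 // ?TU //.
apply: contra_eq_neq key => /= ->; rewrite mulr0 eq_sym oppr_eq0 mulf_neq0 //.
by rewrite inE in jy.
Qed.

(** Descent on the support: a kernel vector [y] of smaller support either contains [a] itself, or
    can be subtracted from [z] without touching [a]. *)
Lemma exists_elementary z a : M *m z = 0 -> a \in supp z ->
  exists y, [/\ elementary y, a \in supp y & supp y \subset supp z].
Proof.
have [k] := ubnP #|supp z|; elim: k z => // k IH z /ltnSE kz Mz az.
have z0 : z != 0 by apply: contraTneq az => ->; rewrite inE mxE eqxx.
have [Ez|nEz] := classic (elementary z); first by exists z; split.
have [y [My y0 yz yNz]] : exists y, [/\ M *m y = 0, y != 0,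
    supp y \subset supp z & supp y <> supp z].
  apply: NNPP => nex; apply: nEz; split=> // y My y0 yz.
  by apply: NNPP => ynz; apply: nex; exists y.
suff [x [Mx ax xz]] : exists x, [/\ M *m x = 0, a \in supp x & supp x \proper supp z].
  have [w [Ew aw wx]] := IH x (leq_trans (proper_card xz) kz) Mx ax.
  by exists w; split=> //; apply: subset_trans (proper_sub xz).
have [ay|ay] := boolP (a \in supp y).
  by exists y; split=> //; rewrite properEneq yz andbT; apply/eqP.
have /set0Pn[b by_] : supp y != set0 by apply: contra_neq y0; exact: supp_eq0.
have yb : y b 0 != 0 by rewrite inE in by_.
(* This multiple of [y] kills the coordinate [b] of [z]. *)
pose c := z b 0 / y b 0.
exists (z - c *: y); split.
- by rewrite mulmxBr -scalemxAr Mz My scaler0 subr0.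
- by move: ay az; rewrite !inE !mxE negbK => /eqP ->; rewrite mulr0 subr0.
apply/properP; split; last first.
  exists b; first exact: (subsetP yz).
  by rewrite inE !mxE negbK /c divfK // subrr.
apply/subsetP => i; rewrite !inE !mxE; apply: contraNneq => zi.
have : i \notin supp y by apply/negP => /(subsetP yz); rewrite inE zi eqxx.
by rewrite inE negbK zi => /eqP ->; rewrite mulr0 subr0.
Qed.

(** Either the column [a] lies in the span of the columns outside [I], which gives [z], or some [u]
    annihilates that span but not the column [a]. *)
Lemma row_space_or_kernel (I : {set 'I_n}) a : a \in I ->
  (exists2 u : 'rV[R]_m, (u *m M) 0 a != 0 & forall j, j \notin I -> (u *m M) 0 j = 0)
  \/ (exists z, [/\ M *m z = 0, z a 0 != 0 & forall j, j \in I -> j != a -> z j 0 = 0]).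
Proof.
move=> aI; pose MI : 'M[R]_(m, n) := \matrix_(i, j) if j \in I then 0 else M i j.
have [/submxP[D MD]|nsub] := boolP ((col a M)^T <= MI^T)%MS; [right|left].
  exists (\col_j ((j == a)%:R - (if j \in I then 0 else D 0 j))); split.
  - apply/colP => i; rewrite !mxE.
    under eq_bigr => j _ do rewrite mxE mulrBr.
    rewrite sumrB (bigD1 a) //= eqxx mulr1 big1 ?addr0; last first.
      by move=> j /negPf ->; rewrite mulr0.
    move/rowP: MD => /(_ i); rewrite !mxE => ->; apply/eqP; rewrite subr_eq0; apply/eqP.
    by apply: eq_bigr => j _; rewrite !mxE; case: ifP => _; rewrite ?mulr0 ?mul0r // mulrC.
  - by rewrite mxE eqxx aI subr0 oner_eq0.
  - by move=> j jI /negPf ja; rewrite mxE ja jI subr0.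
move: nsub; rewrite submxE => /matrix0Pn[i [c]]; rewrite ord1 => nz.
exists (col c (cokermx MI^T))^T.
  apply: contra_neq nz => <-; rewrite !mxE; apply: eq_bigr => k _.
  by rewrite !mxE mulrC.
move=> j jI; have MIc : (MI^T *m cokermx MI^T) j c = 0 by rewrite mulmx_coker mxE.
rewrite -[RHS]MIc !mxE; apply: eq_bigr => k _.
by rewrite !mxE (negPf jI) mulrC.
Qed.

End Elementary.
(** * Rounding along the row space *)

Section Rounding.
Variables (R : realType) (A : finType) (N : oriented_matroid A).

(** Signed incidence vector of a circuit. The value 0 on other signed sets lets families of
    equations be indexed by the whole finite type. *)
Definition chi (C : signed_set A) (a : A) : int :=
  if C \in circuits N then (a \in spos C)%:Z - (a \in sneg C)%:Z else 0.

Variables (m : nat) (M : 'M[R]_(m, #|A|)).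
Hypotheses (TU : totally_unimodular M) (repM : represents M N).

Lemma vsuppE (x : 'cV[R]_#|A|) : vsupp x = [set a | enum_rank a \in supp x].
Proof. by apply/setP => a; rewrite !inE. Qed.

Lemma vsupp_subset (x y : 'cV[R]_#|A|) :
  (vsupp x \subset vsupp y) = (supp x \subset supp y).
Proof.
rewrite !vsuppE; apply/subsetP/subsetP => xy a; last by rewrite !inE; have := xy (enum_rank a); rewrite !inE.
by have := xy (enum_val a); rewrite !inE enum_valK.
Qed.

Lemma mx_circuitP C :
  mx_circuit M C <-> exists2 x, elementary M x & C = (vpos x, vneg x).
Proof.
have vsupp_inj (x y : 'cV[R]_#|A|) : vsupp x = vsupp y <-> supp x = supp y.
  split=> [xy|]; last by rewrite !vsuppE => ->.
  by apply/eqP; rewrite eqEsubset -!vsupp_subset xy subxx.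
split=> [[x [Mx x0 minx ->]]|[x [Mx x0 minx] ->]]; exists x => //; split=> // y My y0.
  by rewrite -vsupp_subset => /(minx _ My y0)/vsupp_inj.
by rewrite vsupp_subset => /(minx _ My y0)/vsupp_inj.
Qed.

Lemma chi_sgr (x : 'cV[R]_#|A|) a : (vpos x, vneg x) \in circuits N ->
  (chi (vpos x, vneg x) a)%:~R = Num.sg (x (enum_rank a) 0).
Proof.
rewrite /chi => ->; rewrite /spos /sneg /= !inE.
by case: ltrgtP => [xa|xa|<-]; rewrite ?sgr0 ?(ltr0_sg xa) ?(gtr0_sg xa).
Qed.

(** By total unimodularity the nonzero entries of an elementary vector have equal absolute value, so
    its sign vector is a multiple of it. *)
Lemma chi_kernel C : M *m \col_j (chi C (enum_val j))%:~R = 0.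
Proof.
have [CN|/negPf CN] := boolP (C \in circuits N); last first.
  apply/colP => i; rewrite !mxE big1 // => j _.
  by rewrite !mxE /chi CN mulr0.
have /mx_circuitP[x Ex Cx] := (repM C).1 CN.
have [Mx x0 _] := Ex.
have /set0Pn[j0 j0x] : supp x != set0 by apply: contra_neq x0; exact: supp_eq0.
have c0 : `|x j0 0| != 0 by rewrite normr_eq0; rewrite inE in j0x.
rewrite -[LHS](scalerK c0) scalemxAr -[RHS](scaler0 _ `|x j0 0|^-1) -Mx.
congr (_ *: (_ *m _)); apply/colP => j; rewrite !mxE.
have E : (vpos x, vneg x) \in circuits N by rewrite -Cx.
rewrite Cx chi_sgr // enum_valK mulrC [RHS]numEsg.
have [->|xj] := eqVneq (x j 0) 0; first by rewrite sgr0 !mul0r.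
by rewrite (elementary_norm (j := j) TU Ex _ j0x) // inE.
Qed.

Lemma chi_row_space C (u : 'rV[R]_m) :
  \sum_a (chi C a)%:~R * (u *m M) 0 (enum_rank a) = 0.
Proof.
have E : (u *m (M *m \col_j (chi C (enum_val j))%:~R)) 0 0 = 0.
  by rewrite chi_kernel mulmx0 mxE.
rewrite mulmxA mxE in E; rewrite -[RHS]E.
rewrite [RHS](reindex enum_rank) /=; last by apply: onW_bij; exact: enum_rank_bij.
by apply: eq_bigr => a _; rewrite [X in _ = _ * X]mxE enum_rankK mulrC.
Qed.

Definition fractional (r : A -> R) : {set A} := [set a | (r a != 0) && (r a != 1)].

(* Either [r] can be moved inside the cube along the row space of [M] until one
   more coordinate becomes integral, or a circuit meets the fractional
   coordinates in a single element, whose value is then integral. *)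
Lemma rounding (r : A -> R) (kappa : signed_set A -> int) :
  (forall a, 0 <= r a <= 1) ->
  (forall C, \sum_a (chi C a)%:~R * r a = (kappa C)%:~R) ->
  exists w : {ffun A -> bool},
    (forall C, \sum_a chi C a * (w a)%:Z = kappa C) /\
    (forall a (b : bool), r a = b%:R -> w a = b).
Proof.
have [k] := ubnP #|fractional r|; elim: k r => // k IH r /ltnSE kr r01 chir.
have [fr0|/set0Pn[a afr]] := eqVneq (fractional r) set0.
  have rE a : r a = (r a == 1)%:R.
    move/setP: fr0 => /(_ a); rewrite !inE.
    by case: (r a =P 1) => [|_]; rewrite //= andbT => /negbFE/eqP.
  exists [ffun a => r a == 1]; split=> [C|a b ra]; last first.
    by rewrite ffunE ra; case: b {ra}; rewrite ?eqxx // eq_sym oner_eq0.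
  apply: (@intr_inj R); rewrite -chir rmorph_sum /=; apply: eq_bigr => a _.
  by rewrite rmorphM /= ffunE [in RHS]rE.
pose I : {set 'I_#|A|} := [set j | enum_val j \in fractional r].
have aI : enum_rank a \in I by rewrite inE enum_rankK.
have [[u ua uI]|[z [Mz za zI]]] := row_space_or_kernel M aI; last first.
  have az : enum_rank a \in supp z by rewrite inE.
  have [y [Ey ay yz]] := exists_elementary Mz az.
  pose C := (vpos y, vneg y).
  have CN : C \in circuits N by apply/repM/mx_circuitP; exists y.
  have chi0 b : b \in fractional r -> b != a -> chi C b = 0.
    move=> bfr ba; apply: (@intr_inj R); rewrite chi_sgr //.
    suff : enum_rank b \notin supp y by rewrite inE negbK => /eqP ->; rewrite sgr0.
    apply/negP => /(subsetP yz); rewrite inE zI ?eqxx //.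
      by rewrite inE enum_rankK.
    by rewrite (inj_eq enum_rank_inj).
  have chia : (chi C a)%:~R * (chi C a)%:~R = 1 :> R.
    by rewrite chi_sgr // -expr2 sqr_sg; rewrite inE in ay; rewrite ay.
  (* Modulo the integers, the relation for [C] reduces to its term at [a], where [chi C a] is a
     sign. *)
  have : r a \is a Num.int.
    rewrite -[r a]mul1r -chia -mulrA rpredM ?intr_int //.
    have := chir C; rewrite (bigD1 a) //= => /(canRL (addrK _)) ->.
    rewrite rpredB ?intr_int // rpred_sum // => b ba.
    have [bfr|] := boolP (b \in fractional r); first by rewrite chi0 // mul0r rpred0.
    rewrite inE negb_and !negbK => /orP[]/eqP ->; first by rewrite mulr0 rpred0.
    by rewrite mulr1 intr_int.
  case/intrP => n rn; move: (r01 a) afr; rewrite inE rn.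
  by rewrite -[0]/(0%:~R) -[1]/(1%:~R) !ler_int !eqr_int; lia.
pose d b := (u *m M) 0 (enum_rank b).
have dfr b : d b != 0 -> b \in fractional r.
  by apply: contraNT => bfr; rewrite /d uI // inE enum_rankK.
(* The time at which the coordinate [b], moving with speed [d b], reaches the end of the unit
   interval. At the minimal time [s] all coordinates are still inside and [b0] is at 0 or 1. *)
pose step b := if 0 < d b then (1 - r b) / d b else - r b / d b.
pose s := step [arg min_(b < a | d b != 0) step b]%O.
have [b0 db0 [sE smin]] : exists2 b0, d b0 != 0 & s = step b0 /\ forall b, d b != 0 -> s <= step b.
  by rewrite /s; case: arg_minP => // b0 db0 smin; exists b0.
have s0 : 0 <= s.
  rewrite sE /step; case: ifPn => db; last rewrite -leNgt in db.
    by rewrite divr_ge0 ?(ltW db) // subr_ge0; case/andP: (r01 b0).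
  by rewrite -mulrNN -invrN opprK divr_ge0 ?oppr_ge0 //; case/andP: (r01 b0).
pose r' b := r b + s * d b.
have r'01 b : 0 <= r' b <= 1.
  have /andP[rb0 rb1] := r01 b; rewrite /r'.
  have [->|db] := eqVneq (d b) 0; first by rewrite mulr0 addr0 rb0.
  have := smin b db; rewrite /step; case: ltrgtP db => // db _.
    rewrite ler_pdivlMr // => sd; have := mulr_ge0 s0 (ltW db); lra.
  rewrite ler_ndivlMr // => sd; have := mulr_ge0_le0 s0 (ltW db); lra.
have r'b0 : (r' b0 == 0) || (r' b0 == 1).
  rewrite /r' sE /step; case: ifP => _; rewrite divfK //.
    by rewrite addrC subrK eqxx orbT.
  by rewrite subrr eqxx.
have fr' : fractional r' \proper fractional r.
  apply/properP; split; last by exists b0; rewrite ?dfr // inE -negb_or r'b0.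
  apply/subsetP => b; apply: contraTT => bfr.
  have /eqP db : d b == 0 by apply: contraNT bfr; exact: dfr.
  by move: bfr; rewrite !inE /r' db mulr0 addr0.
have chir' C : \sum_b (chi C b)%:~R * r' b = (kappa C)%:~R.
  rewrite -chir /r'; under eq_bigr => b _ do rewrite mulrDr mulrCA.
  by rewrite big_split /= -mulr_sumr chi_row_space mulr0 addr0.
have [w [chiw rw]] := IH r' (leq_trans (proper_card fr') kr) r'01 chir'.
(* Integral coordinates have speed 0, so their values pass unchanged to [w]. *)
exists w; split=> // b c rb; apply: rw; rewrite /r'.
have [->|/dfr] := eqVneq (d b) 0; first by rewrite mulr0 addr0.
by rewrite inE rb; case: c {rb}; rewrite eqxx ?andbF.
Qed.

End Rounding.
(** * Lattice points of prescribed parity in dilates *)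

Lemma card_set_pred (X : finType) (S : {set X}) (P : pred X) :
  #|[set x in S | P x]|%:R = \sum_(x in S) (P x)%:R :> rat.
Proof.
rewrite -sum1_card natr_sum [RHS](bigID P) /= [X in _ + X]big1 ?addr0.
  by apply: eq_big => [x|x]; rewrite !inE // => /andP[_ ->].
by move=> x /andP[_ /negPf ->].
Qed.

Lemma inclusion_exclusion (X I : finType) (S : {set X}) (t : I -> pred X) :
  #|[set x in S | ~~ [exists i, t i x]]|%:R =
  \sum_(J : {set I}) (-1) ^+ #|J| * #|[set x in S | [forall i in J, t i x]]|%:R :> rat.
Proof.
under [RHS]eq_bigr => J _ do rewrite card_set_pred mulr_sumr.
rewrite card_set_pred exchange_big /=; apply: eq_bigr => x _.
(* The indicator of avoiding every [t i], as a product to be expanded over subsets [J]. *)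
transitivity (\prod_i (- (t i x)%:R + 1) : rat).
  have [/existsP[i tix]|] := boolP [exists i, t i x].
    by rewrite (bigD1 i) //= tix addNr mul0r.
  rewrite negb_exists => /forallP nt; rewrite big1 // => i _.
  by rewrite (negPf (nt i)) oppr0 add0r.
rewrite bigA_distr; apply: eq_big => // J _.
rewrite -big_mkcond /= prodrN; congr (_ * _).
have [/forall_inP tJ|] := boolP [forall i in J, t i x].
  by rewrite big1 // => i /tJ ->.
by case/forall_inPn => i iJ /negPf ti; rewrite (bigD1 i) //= ti mul0r.
Qed.

Section Boxes.
Variables (I A : finType) (chi : I -> A -> int).
Implicit Types (kappa : I -> int) (p w : {ffun A -> bool}).
Implicit Types sigma : {ffun A -> option bool}.

(* The points of the lattice polytope [0 <= x <= q, chi x = q kappa] with parity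
   vector [p] on the face where [x a = 0] if [sigma a = Some false] and [x a = q]
   if [sigma a = Some true]. *)
Definition box q kappa p sigma : {set {ffun A -> 'I_q.+1}} :=
  [set x : {ffun A -> 'I_q.+1} |
    [&& [forall i, \sum_a chi i a * (x a)%:Z == kappa i * q%:Z],
        [forall a, odd (x a) == p a]
      & [forall a, if sigma a is Some b then x a == (b * q)%N :> nat else true]]].

Lemma boxP q kappa p sigma (x : {ffun A -> 'I_q.+1}) :
  reflect [/\ forall i, \sum_a chi i a * (x a)%:Z = kappa i * q%:Z,
              forall a, odd (x a) = p a
            & forall a b, sigma a = Some b -> x a = (b * q)%N :> nat]
          (x \in box q kappa p sigma).
Proof.
rewrite inE; apply: (iffP and3P) => [[/forallP h1 /forallP h2 /forallP h3]|[h1 h2 h3]].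
  split=> [i|a|a b sa]; [exact/eqP|exact/eqP|].
  by have := h3 a; rewrite sa => /eqP.
split; apply/forallP => a; [exact/eqP|exact/eqP|].
by case E: (sigma a) => [b|//]; apply/eqP/h3.
Qed.

Definition flip p w : {ffun A -> bool} := [ffun a => p a (+) w a].

Lemma flipK p w : flip (flip p w) w = p.
Proof. by apply/ffunP => a; rewrite !ffunE -addbA addbb addbF. Qed.

(** A free coordinate sits at the end opposite to the one chosen by [w]. *)
Definition far w sigma q a (x : {ffun A -> 'I_q.+1}) :=
  (sigma a == None) && (x a == (~~ w a * q)%N :> nat).

(* Translation by the vertex [w] maps the dilate by [q] onto the points of the
   dilate by [q + 1] that lie on no facet avoiding [w]. *)
Lemma card_box_not_far q kappa p sigma w :
  (forall i, \sum_a chi i a * (w a)%:Z = kappa i) ->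
  (forall a b, sigma a = Some b -> w a = b) ->
  #|[set x in box q.+1 kappa p sigma | ~~ [exists a, far w sigma a x]]| =
  #|box q kappa (flip p w) sigma|.
Proof.
move=> chiw sw.
pose up (x : {ffun A -> 'I_q.+1}) : {ffun A -> 'I_q.+2} := [ffun a => inord (x a + w a)].
have upE x a : up x a = (x a + w a)%N :> nat.
  by rewrite ffunE inordK // ltnS; have := ltn_ord (x a); case: (w a); lia.
have up_inj : injective up.
  move=> x y xy; apply/ffunP => a; apply/val_inj/(@addIn (w a)).
  by rewrite /= -!upE xy.
rewrite -(card_imset _ up_inj); apply: eq_card => y; rewrite inE.
apply/andP/imsetP => [[/boxP[h1 h2 h3]]|[x /boxP[h1 h2 h3] ->]].
  rewrite negb_exists => /forallP nf.
  have yw a : (w a <= y a)%N && (y a - w a < q.+1)%N.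
    have := nf a; have := ltn_ord (y a); have := h3 a; have := sw a.
    rewrite /far; case: (sigma a) => [b /(_ _ erefl) wb /(_ _ erefl) |_ _] /=.
      by move=> ->; case: b wb => ->; lia.
    by case: (w a) => /= /[swap] /eqP; lia.
  pose x : {ffun A -> 'I_q.+1} := [ffun a => inord (y a - w a)].
  have xE a : x a = (y a - w a)%N :> nat.
    by rewrite ffunE inordK //; case/andP: (yw a).
  have yx a : y a = (x a + w a)%N :> nat by rewrite xE subnK //; case/andP: (yw a).
  exists x; last by apply/ffunP => a; apply/val_inj; rewrite /= upE -yx.
  apply/boxP; split=> [i|a|a b sa].
  - apply: (@addIr _ (kappa i)); rewrite -{1}chiw -big_split /=.
    under eq_bigr => a _ do rewrite -mulrDr -PoszD -yx.
    by rewrite h1 intS; ring.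
  - by rewrite [RHS]ffunE -h2 yx oddD oddb -addbA addbb addbF.
  - by have := h3 _ _ sa; rewrite yx (sw _ _ sa); lia.
split.
  apply/boxP; split=> [i|a|a b sa].
  - under eq_bigr => a _ do rewrite upE PoszD mulrDr.
    by rewrite big_split /= h1 chiw intS; ring.
  - by rewrite upE oddD oddb h2 ffunE -addbA addbb addbF.
  - by rewrite upE (h3 _ _ sa) (sw _ _ sa); lia.
rewrite negb_exists; apply/forallP => a; rewrite /far upE negb_and.
by have := ltn_ord (x a); case: (w a) => /=; lia.
Qed.

(** Intersecting with far facets fixes further coordinates, so the points missed by a translation
    are counted on smaller faces. *)
Lemma box_far q kappa p sigma w (J : {set A}) :
  [set x in box q kappa p sigma | [forall a in J, far w sigma a x]] =
  if [forall a in J, sigma a == None]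
  then box q kappa p [ffun a => if a \in J then Some (~~ w a) else sigma a]
  else set0.
Proof.
apply/setP => x; rewrite inE; case: ifPn => [/forall_inP sJ|]; last first.
  case/forall_inPn => a aJ sa; rewrite in_set0; apply: negbTE; rewrite negb_and.
  apply/orP; right; apply/forall_inPn; exists a => //.
  by rewrite negb_and sa.
apply/andP/boxP => [[/boxP[h1 h2 h3] /forall_inP hf]|[h1 h2 h3]].
  split=> // a b; rewrite ffunE; case: ifP => [aJ [<-]|_]; last exact: h3.
  by have /andP[_ /eqP] := hf _ aJ.
split.
  apply/boxP; split=> // a b sa; apply: h3; rewrite ffunE.
  by case: ifP => // /sJ; rewrite sa.
apply/forall_inP => a aJ; rewrite /far sJ //=; apply/eqP/h3.
by rewrite ffunE aJ.
Qed.

(** Integrality of the polytopes: the face containing [x / q] has a 0/1 point. Regularity of the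
    matroid enters through this property. *)
Hypothesis box_rounding : forall kappa q (x : {ffun A -> 'I_q.+1}), (0 < q)%N ->
  (forall i, \sum_a chi i a * (x a)%:Z = kappa i * q%:Z) ->
  exists w, (forall i, \sum_a chi i a * (w a)%:Z = kappa i) /\
            (forall a (b : bool), x a = (b * q)%N :> nat -> w a = b).

(** Induction on the number of free coordinates, through the second difference in [q] produced by
    two translations by [w]. *)
Lemma box_quasi_poly kappa p sigma :
  quasi_poly (fun q => #|box q kappa p sigma|%:R).
Proof.
have [n] := ubnP #|[set a | sigma a == None]|.
elim: n sigma p => // n IH sigma p /ltnSE fn.
have [/existsP[w /andP[/forallP chiw /forallP sw]]|nw] :=
  boolP [exists w : {ffun A -> bool}, [forall i, \sum_a chi i a * (w a)%:Z == kappa i] &&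
                      [forall a, if sigma a is Some b then w a == b else true]]; last first.
  (* If the face has no 0/1 point, rounding shows that no positive dilate has a point on it. *)
  apply: eq_quasi_poly quasi_poly0 => q q0; apply/esym/eqP.
  rewrite pnatr_eq0 cards_eq0; apply/eqP/setP => x; rewrite in_set0.
  apply: contraNF nw => /boxP[h1 h2 h3]; have [w [chiw xw]] := box_rounding q0 h1.
  apply/existsP; exists w; apply/andP; split; apply/forallP => a; first exact/eqP.
  by case E: (sigma a) => [b|//]; apply/eqP/xw/h3.
have {}chiw i : \sum_a chi i a * (w a)%:Z = kappa i by exact/eqP.
have {}sw a b : sigma a = Some b -> w a = b by move=> sa; have := sw a; rewrite sa => /eqP.
(* By inclusion-exclusion, minus the number of points on some far facet. *)
pose D p' q : rat := \sum_(J : {set A} | J != set0) (-1) ^+ #|J| *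
  #|[set x in box q kappa p' sigma | [forall a in J, far w sigma a x]]|%:R.
have qpD p' : quasi_poly (D p').
  apply: quasi_poly_sum => J J0; apply: quasi_polyM.
  have [sJ|nsJ] := boolP [forall a in J, sigma a == None]; last first.
    apply: eq_quasi_poly quasi_poly0 => q _.
    by rewrite box_far (negPf nsJ) cards0.
  apply: eq_quasi_poly (IH [ffun a => if a \in J then Some (~~ w a) else sigma a] p' _).
    by move=> q _; rewrite box_far sJ.
  apply: leq_trans fn; apply/proper_card/properP; split.
    by apply/subsetP => a; rewrite !inE ffunE; case: ifP.
  case/set0Pn: J0 => a aJ; exists a; last by rewrite inE ffunE aJ.
  by rewrite inE; move/forall_inP: sJ => /(_ _ aJ).
have stepD p' q : #|box q kappa (flip p' w) sigma|%:R =
    #|box q.+1 kappa p' sigma|%:R + D p' q.+1.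
  rewrite -(card_box_not_far q p' chiw sw) inclusion_exclusion (bigD1 set0) //=.
  rewrite cards0 expr0 mul1r; congr (_%:R + _); apply: eq_card => x.
  by rewrite inE andb_idr // => _; apply/forall_inP => a; rewrite inE.
apply: quasi_poly_antidiff.
apply: eq_quasi_poly (quasi_polyD (quasi_polyM (-1) (quasi_poly_shift (quasi_poly_shift (qpD p))))
                 (quasi_polyM (-1) (quasi_poly_shift (qpD (flip p w))))).
(* Two translations flip the parities by [w] twice and restore [p]; only the terms [D] remain in the
   difference. *)
move=> q _; have := stepD p q.+1; have := stepD (flip p w) q; rewrite flipK => -> ->.
by ring.
Qed.

End Boxes.
(** * Polynomials in q, y, z determined by odd values of q *)

Lemma specialize_qC (c : rat) q : specialize_q c%:MP q = c%:MP.
Proof. exact: comp_mpolyC. Qed.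

Lemma specialize_qX0 q : specialize_q 'X_ord0 q = q%:R.
Proof. by rewrite /specialize_q comp_mpolyXU. Qed.

Lemma specialize_qY q : specialize_q Yvar q = Yvar.
Proof. by rewrite /specialize_q comp_mpolyXU inordK. Qed.

Lemma specialize_qZ q : specialize_q Zvar q = Zvar.
Proof. by rewrite /specialize_q comp_mpolyXU inordK. Qed.

Definition odd_poly_fun (F : nat -> {mpoly rat[3]}) :=
  exists P, forall q, odd q -> specialize_q P q = F q.

Lemma odd_poly_fun_const c :
  (forall q, specialize_q c q = c) -> odd_poly_fun (fun=> c).
Proof. by exists c. Qed.

Lemma odd_poly_funM F G :
  odd_poly_fun F -> odd_poly_fun G -> odd_poly_fun (fun q => F q * G q).
Proof.
move=> [P HP] [Q HQ]; exists (P * Q) => q oq.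
by rewrite /specialize_q rmorphM /= -!/(specialize_q _ _) HP ?HQ.
Qed.

Lemma odd_poly_fun_sum (J : finType) (F : J -> nat -> {mpoly rat[3]}) :
  (forall j, odd_poly_fun (F j)) -> odd_poly_fun (fun q => \sum_j F j q).
Proof.
move=> /fin_all_exists[P HP]; exists (\sum_j P j) => q oq.
rewrite /specialize_q rmorph_sum /=; apply: eq_bigr => j _.
by rewrite -/(specialize_q _ _) HP.
Qed.

(** At odd arguments only the constituent [P true] is seen. *)
Lemma odd_poly_fun_quasi_poly (F : nat -> rat) :
  quasi_poly F -> odd_poly_fun (fun q => (F q)%:MP).
Proof.
case=> P HP; pose p := P true.
exists (\sum_(i < size p) (p`_i)%:MP * 'X_ord0 ^+ i) => q oq.
rewrite HP ?odd_gt0 // oq -/p horner_coef /specialize_q !rmorph_sum /=.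
apply: eq_bigr => i _; rewrite !rmorphM !rmorphXn /= -!/(specialize_q _ _).
by rewrite specialize_qC specialize_qX0 rmorph_nat.
Qed.

(** * Uniqueness from infinitely many odd values *)

Lemma poly_eq0_odd (p : {poly rat}) :
  (forall q, odd q -> p.[q%:R] = 0) -> p = 0.
Proof.
move=> p0; apply/eqP/negPn/negP => pn0.
pose rs : seq rat := [seq i.*2.+1%:R | i <- iota 0 (size p)].
have : (size rs < size p)%N.
  apply: max_poly_roots => //.
    by apply/allP => _ /mapP[i _ ->]; rewrite /root p0 //= odd_double.
  rewrite map_inj_in_uniq ?iota_uniq // => i j _ _ /eqP.
  by rewrite eqr_nat eqSS => /eqP /double_inj.
by rewrite size_map size_iota ltnn.
Qed.

(** The coefficient of each monomial in [y] and [z] is a polynomial in [q] that vanishes at every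
    odd number. *)
Lemma specialize_q_eq0 (P : {mpoly rat[3]}) :
  (forall q, odd q -> specialize_q P q = 0) -> P = 0.
Proof.
move=> P0; apply/mpolyP => m; rewrite mcoeff0.
pose e (k : 'X_{1..3}) : 'X_{1..3} := (U_(inord 1) *+ k (inord 1) + U_(inord 2) *+ k (inord 2))%MM.
pose p := \sum_(k <- msupp P | e k == e m) P@_k *: 'X^(k ord0) : {poly rat}.
have p0 : p = 0.
  apply: poly_eq0_odd => q oq; rewrite horner_sum.
  have Pq : (specialize_q P q)@_(e m) = 0 by rewrite P0 // mcoeff0.
  rewrite -[RHS]Pq /specialize_q comp_mpolyE raddf_sum /= big_mkcond /=; apply: eq_bigr => k _.
  rewrite !big_ord_recl big_ord0 mulr1 !(tnth_nth 0) /=.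
  have -> : lift ord0 ord0 = inord 1 :> 'I_3 by apply/val_inj; rewrite /= inordK.
  have -> : lift ord0 (lift ord0 ord0) = inord 2 :> 'I_3.
    by apply/val_inj; rewrite /= inordK.
  have -> : Yvar ^+ k (inord 1) * Zvar ^+ k (inord 2) = 'X_[e k].
    by rewrite mpolyXD !mpolyXn.
  rewrite mcoeffZ -natrX -mpolyC_nat mcoeffCM mcoeffX natrX.
  by case: eqP => _; rewrite ?mulr0 // hornerZ hornerXn mulr1.
have pm : p`_(m ord0) = 0 by rewrite p0 coef0.
rewrite -[RHS]pm coef_sum.
(* A monomial is determined by its [y], [z] part and its exponent of [q], so the coefficient of [p]
   at [m ord0] is that of [P] at [m]. *)
have eP k : (e k == e m) && (k ord0 == m ord0) = (k == m).
  apply/andP/eqP => [[/eqP ekm /eqP k0]|->//].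
  apply/mnmP => i; move/mnmP: ekm => ekm.
  have := ekm i; rewrite !mnmDE !mulmnE !mnm1E -!(inj_eq val_inj) /= !inordK //.
  case: i => [[|[|[|//]]] Hi] /=.
  - by move=> _; rewrite (_ : Ordinal Hi = ord0) //; exact/val_inj.
  - by rewrite (_ : Ordinal Hi = inord 1) ?mul1n ?mul0n ?addn0 //; apply/val_inj; rewrite /= inordK.
  - by rewrite (_ : Ordinal Hi = inord 2) ?mul1n ?mul0n //; apply/val_inj; rewrite /= inordK.
under eq_bigr => k _ do rewrite coefZ coefXn eq_sym.
rewrite (bigID (fun k : 'X_{1..3} => k ord0 == m ord0)) /= [X in _ + X]big1 ?addr0; last first.
  by move=> k /andP[_ /negPf ->]; rewrite mulr0.
rewrite (eq_bigl _ _ eP).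
have [mP|mP] := boolP (m \in msupp P).
  by rewrite -big_filter filter_pred1_uniq ?msupp_uniq // big_seq1 eqxx mulr1.
rewrite memN_msupp_eq0 // big_seq_cond big1 // => k /andP[kP /eqP km].
by rewrite -km kP in mP.
Qed.
(** * Coflows as lattice points *)

Section CoflowSum.
Variables (A : finType) (N : oriented_matroid A).

Lemma dvdz_chi_sum (q : nat) (f : A -> nat) C : C \in circuits N ->
  (q%:Z %| \sum_a chi N C a * (f a)%:Z)%Z =
  (\sum_(a in spos C) f a == \sum_(a in sneg C) f a %[mod q])%N.
Proof.
move=> CN; rewrite -eqz_nat -!modz_nat eqz_mod_dvd -!natz !natr_sum.
congr (_ %| _)%Z; rewrite [X in X - _]big_mkcond [X in _ - X]big_mkcond -sumrB.
apply: eq_bigr => a _; rewrite /chi CN !natz mulrBl.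
by do 2!case: ifP => _; rewrite ?mul1r ?mul0r.
Qed.

Lemma coflowE n (f : {ffun A -> 'I_n.+1}) :
  (f \in coflows N n.+1) =
  [forall C, (n.+1%:Z %| \sum_a chi N C a * (f a)%:Z)%Z].
Proof.
have sumE (S : {set A}) : \sum_(a in S) f a = inZp (\sum_(a in S) f a)%N :> 'I_n.+1.
  rewrite (big_morph (inZp : nat -> 'I_n.+1) (id1 := 0) (op1 := +%R)).
  - by apply: eq_bigr => a _; rewrite valZpK.
  - by move=> x y; apply/val_inj; rewrite /= modnDm.
  - by apply/val_inj; rewrite /= mod0n.
have chiE C : C \in circuits N -> (n.+1%:Z %| \sum_a chi N C a * (f a)%:Z)%Z =
    (\sum_(a in spos C) f a - \sum_(a in sneg C) f a == 0).
  by move=> CN; rewrite dvdz_chi_sum // subr_eq0 !sumE.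
rewrite inE; apply/forall_inP/forallP => h C; last by move=> CN; rewrite -chiE.
have [CN|/negPf CN] := boolP (C \in circuits N); first by rewrite chiE ?h.
by rewrite big1 ?dvdz0 // => a _; rewrite /chi CN mul0r.
Qed.

(** * Doubling residues modulo an odd number *)

Definition double_residue n (i : 'I_n.+1) : nat := (i.*2 %% n.+1)%N.
(** For an odd modulus [n.+1], an odd [j] becomes even after adding the modulus. *)
Definition halve_residue n (j : nat) : nat := ((j + odd j * n.+1)./2)%N.

Lemma double_residueE n (i : 'I_n.+1) : odd n.+1 ->
  double_residue i = (if i <= n.+1./2 then i.*2 else i.*2 - n.+1)%N.
Proof.
move=> on; rewrite /double_residue; have := odd_double_half n.+1; rewrite on.
have := ltn_ord i; case: (leqP i n.+1./2) => hi lti En.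
  rewrite modn_small; lia.
by rewrite -{1}(@subnK n.+1 i.*2) ?modnDr ?modn_small //; lia.
Qed.

Lemma double_residueK n (i : 'I_n.+1) : odd n.+1 -> halve_residue n (double_residue i) = i.
Proof.
move=> on; rewrite double_residueE // /halve_residue.
have := odd_double_half n.+1; rewrite on => En.
have [hi|hi] := leqP i n.+1./2; first by rewrite odd_double mul0n addn0 doubleK.
have lt2i : (n.+1 <= i.*2)%N by lia.
by rewrite oddB // odd_double on mul1n subnK // doubleK.
Qed.

Lemma halve_residueK n j : odd n.+1 -> (j < n.+1)%N ->
  ((halve_residue n j).*2 %% n.+1)%N = j.
Proof.
move=> on lj; rewrite /halve_residue.
have -> : ((j + odd j * n.+1)./2.*2 = j + odd j * n.+1)%N by lia.
by case: (odd j); rewrite ?mul1n ?modnDr ?addn0 modn_small.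
Qed.

Lemma mem_lower_half n (i : 'I_n.+1) :
  (i \in lower_half n.+1) = (0 < i <= n.+1./2)%N.
Proof.
have En := odd_double_half n.+1.
have lt_half (s : nat) : (0 < s <= n.+1./2)%N -> (s < n.+1)%N.
  by move: (odd _) En => b En; lia.
apply/mapP/idP => [[s]|hi]; rewrite ?mem_iota ?add1n ?ltnS.
  by move=> hs -> /=; rewrite modn_small // lt_half.
by exists (val i); rewrite ?valZpK // mem_iota add1n ltnS.
Qed.

(* The weight [y^[v in {1..q/2}] z^[-v in {1..q/2}]] of a residue [v], written in
   terms of [2v mod q] as a combination of the indicators of the parity classes
   and of the endpoints [0] and [q]; [true] in the second slot marks an endpoint. *)
Definition cell_coeff (s : bool * bool) : {mpoly rat[3]} :=
  match s with
  | (false, false) => Yvar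
  | (true, false) => Zvar
  | (false, true) => 1 - Yvar
  | (true, true) => - Zvar
  end.

Definition in_cell q (s : bool * bool) (j : nat) : bool :=
  (odd j == s.1) && (if s.2 then j == (s.1 * q)%N else true).

Definition weight q j := \sum_s cell_coeff s * (in_cell q s j)%:R.

(** The endpoint terms correct the parity weight from [y] to 1 at 0 and from [z] to 0 at [q]. The
    zero at [q] allows sums over the closed cube. *)
Lemma weightE q j : odd q -> weight q j =
  if j == q then 0 else if j == 0%N then 1 else if odd j then Zvar else Yvar.
Proof.
move=> oq; have -> : weight q j =
    \sum_(b : bool) \sum_(c : bool) cell_coeff (b, c) * (in_cell q (b, c) j)%:R.
  by rewrite pair_bigA /=; apply: eq_bigr => -[].
rewrite !big_bool /= /in_cell /= mul0n mul1n.
have [->|jq] := eqVneq j q; first by rewrite oq /=; ring.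
have [->|j0] /= := eqVneq j 0%N; first by ring.
by case: (odd j) => /=; ring.
Qed.

(** Residues in the lower half double to even numbers without wrapping; the larger ones wrap once,
    and subtracting the odd modulus makes them odd. *)
Lemma weight_double n (i : 'I_n.+1) : odd n.+1 ->
  weight n.+1 (double_residue i) =
  Yvar ^+ (i \in lower_half n.+1) * Zvar ^+ (- i \in lower_half n.+1).
Proof.
move=> on; rewrite weightE // !mem_lower_half double_residueE //.
have -> : nat_of_ord (- i) = ((n.+1 - i) %% n.+1)%N by [].
have := odd_double_half n.+1; rewrite on; set h := (n.+1)./2 => En.
have lti := ltn_ord i; have [i0|i0] := posnP (i : nat).
  by rewrite i0 subn0 modnn /= mulr1.
rewrite [((_ - i) %% _)%N]modn_small; last by lia.
have [hi|hi] := leqP i h.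
  have -> : (i.*2 == n.+1) = false by lia.
  have -> : (i.*2 == 0)%N = false by lia.
  have -> : (0 < n.+1 - i <= h)%N = false by lia.
  by rewrite odd_double mulr1.
have -> : (i.*2 - n.+1 == n.+1)%N = false by lia.
have -> : (i.*2 - n.+1 == 0)%N = false by lia.
have -> : (0 < n.+1 - i <= h)%N by lia.
by rewrite oddB ?odd_double ?on ?mul1r //; lia.
Qed.

Lemma prod_half_weight q (f : {ffun A -> Zmod q}) :
  Yvar ^+ #|fgt f| * Zvar ^+ #|flt f| =
  \prod_a (Yvar ^+ (f a \in lower_half q) * Zvar ^+ (- f a \in lower_half q)).
Proof.
rewrite big_split /= -!prodr_const; congr (_ * _); rewrite big_mkcond;
  by apply: eq_bigr => a _; rewrite inE; case: (_ \in _).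
Qed.

(** Doubling is a bijection modulo an odd number and preserves coflows in both directions. *)
Lemma coflow_sum_double n : odd n.+1 ->
  \sum_(f in coflows N n.+1) Yvar ^+ #|fgt f| * Zvar ^+ #|flt f| =
  \sum_(x : {ffun A -> 'I_n.+2} |
        [forall C, (n.+1%:Z %| \sum_a chi N C a * (x a)%:Z)%Z])
    \prod_a weight n.+1 (x a).
Proof.
move=> on.
rewrite [RHS](bigID (fun x : {ffun A -> 'I_n.+2} => [forall a, x a < n.+1]%N)) /=.
rewrite [X in _ + X]big1 ?addr0; last first.
  move=> x /andP[_]; rewrite negb_forall => /existsP[a]; rewrite -leqNgt => xa.
  have {}xa : x a = n.+1 :> nat by apply/eqP; rewrite eqn_leq xa andbT -ltnS ltn_ord.
  by rewrite (bigD1 a) //= weightE // xa eqxx mul0r.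
pose dbl (f : {ffun A -> 'I_n.+1}) : {ffun A -> 'I_n.+2} :=
  [ffun a => inord (double_residue (f a))].
pose hlv (x : {ffun A -> 'I_n.+2}) : {ffun A -> 'I_n.+1} :=
  [ffun a => inZp (halve_residue n (x a))].
have lt_dbl (i : 'I_n.+1) : (double_residue i < n.+1)%N by rewrite ltn_mod.
have dblE f a : dbl f a = double_residue (f a) :> nat.
  by rewrite ffunE inordK // ltnW // ltnS.
have hlvK (x : {ffun A -> 'I_n.+2}) : [forall a, x a < n.+1]%N -> dbl (hlv x) = x.
  move=> /forallP ltx; apply/ffunP => a; apply/val_inj; rewrite /= dblE ffunE.
  by rewrite /double_residue /= -muln2 modnMml muln2 halve_residueK.
have dblK f : hlv (dbl f) = f.
  by apply/ffunP => a; rewrite ffunE dblE double_residueK // valZpK.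
rewrite [RHS](reindex_onto dbl hlv) => [|x /andP[_]]; last exact: hlvK.
apply: eq_big => [f|f _]; last first.
  rewrite prod_half_weight; apply: eq_bigr => a _.
  by rewrite dblE weight_double.
rewrite dblK eqxx andbT.
have -> : [forall a, dbl f a < n.+1]%N by apply/forallP => a; rewrite dblE.
rewrite andbT coflowE; apply: eq_forallb => C.
(* Reducing [2 f] changes the sum by a multiple of the modulus, and the factor 2 is coprime to the
   modulus. *)
have -> : \sum_a chi N C a * (dbl f a)%:Z =
    2 * (\sum_a chi N C a * (f a)%:Z) - n.+1%:Z * \sum_a chi N C a * ((f a).*2 %/ n.+1)%:Z.
  rewrite !mulr_sumr -sumrB; apply: eq_bigr => a _; rewrite dblE.
  have := divn_eq (f a).*2 n.+1; rewrite -/(double_residue _) => E.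
  have {}E : 2 * (f a)%:Z = ((f a).*2 %/ n.+1)%:Z * n.+1%:Z + (double_residue (f a))%:Z.
    by rewrite -PoszM -PoszD -E -mul2n PoszM.
  by rewrite mulrCA E; ring.
rewrite [RHS]rpredBr; last exact: dvdz_mulr.
rewrite Gauss_dvdzr //.
by rewrite coprimezE /= coprimen2.
Qed.

(** Encodes vectors with entries in [[-#|A|, #|A|]] by a finite type independent of [q]. *)
Definition shifted (k : {ffun signed_set A -> 'I_#|A|.*2.+1}) C : int :=
  (k C)%:Z - #|A|%:Z.

Lemma norm_chi_sum q (x : {ffun A -> 'I_q.+1}) C :
  `|\sum_a chi N C a * (x a)%:Z| <= #|A|%:Z * q%:Z.
Proof.
apply: le_trans (ler_norm_sum _ _ _) _.
apply: (@le_trans _ _ (\sum_(a : A) q%:Z)); last by rewrite sumr_const -mulr_natl natz.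
apply: ler_sum => a _; rewrite normrM -[leRHS]mul1r ler_pM //.
  by rewrite /chi; case: ifP => // _; do 2!case: (_ \in _).
by rewrite ger0_norm // lez_nat -ltnS.
Qed.

(* For [0 <= x <= q] each quotient [chi x / q] lies between [-#|A|] and [#|A|]. *)
Lemma coflow_sum_box q : odd q ->
  \sum_(x : {ffun A -> 'I_q.+1} |
        [forall C, (q%:Z %| \sum_a chi N C a * (x a)%:Z)%Z])
    \prod_a weight q (x a) =
  \sum_k \sum_(t : {ffun A -> bool * bool}) (\prod_a cell_coeff (t a)) *
    (#|box (chi N) q (shifted k) [ffun a => (t a).1]
           [ffun a => if (t a).2 then Some (t a).1 else None]|%:R : rat)%:MP.
Proof.
move=> oq; have q0 : q%:Z != 0 by case: q oq.
(* The bound [norm_chi_sum] makes [absz] and [inord] exact whenever the divisibility conditions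
   hold. *)
pose quo (x : {ffun A -> 'I_q.+1}) : {ffun signed_set A -> 'I_#|A|.*2.+1} :=
  [ffun C => inord (absz (divz (\sum_a chi N C a * (x a)%:Z) q%:Z + #|A|%:Z))].
have quoE (x : {ffun A -> 'I_q.+1}) : [forall C, (q%:Z %| \sum_a chi N C a * (x a)%:Z)%Z] ->
    forall C, shifted (quo x) C * q%:Z = \sum_a chi N C a * (x a)%:Z.
  move=> /forallP dvd C; have := norm_chi_sum x C; have := dvd C.
  rewrite /shifted ffunE; set s := \sum_a _ => /dvdzP[c ->].
  rewrite mulzK // normrM (ger0_norm (le0z_nat q)) ler_pM2r; last by rewrite lt0r q0.
  move=> hc; rewrite inordK; last by lia.
  by congr (_ * _); lia.
rewrite (partition_big quo predT) //=; apply: eq_bigr => k _.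
have condE (x : {ffun A -> 'I_q.+1}) :
    [forall C, (q%:Z %| \sum_a chi N C a * (x a)%:Z)%Z] && (quo x == k) =
    [forall C, \sum_a chi N C a * (x a)%:Z == shifted k C * q%:Z].
  apply/andP/forallP => [[dvd /eqP <-] C|h]; first by rewrite quoE.
  have dvd : [forall C, (q%:Z %| \sum_a chi N C a * (x a)%:Z)%Z].
    by apply/forallP => C; rewrite (eqP (h C)) dvdz_mull.
  split=> //; apply/eqP/ffunP => C; apply/val_inj/eqP.
  have := quoE _ dvd C; rewrite (eqP (h C)) => /(mulIf q0) /addIr /eqP.
  by rewrite eqz_nat.
rewrite (eq_bigl _ _ condE).
(* Expanding the product chooses a cell [t a] for each element: a parity vector together with a
   face. *)
under eq_bigr => x _ do rewrite /weight bigA_distr_bigA /=.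
rewrite exchange_big /=; apply: eq_bigr => t _.
under eq_bigr => x _ do rewrite big_split /=.
rewrite -mulr_sumr; congr (_ * _).
rewrite rmorph_nat -sum1_card natr_sum big_mkcond [RHS]big_mkcond /=.
apply: eq_bigr => x _; rewrite inE.
case: [forall C, _ == _] => //=.
set b := (X in if X then _ else _).
have bE : b = [forall a, in_cell q (t a) (x a)].
  apply/andP/forallP => [[/forallP h1 /forallP h2] a|h].
    have := h1 a; have := h2 a; rewrite !ffunE /in_cell => h2a ->.
    by case: ((t a).2) h2a.
  split; apply/forallP => a; rewrite !ffunE; have /andP[] := h a => //.
  by case: ((t a).2).
rewrite bE; case: ifPn => [/forallP h|].
  by rewrite big1 // => a _; rewrite h.
by rewrite negb_forall => /existsP[a /negPf ha]; rewrite (bigD1 a) //= ha mul0r.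
Qed.

End CoflowSum.

(** * Existence and uniqueness for regular oriented matroids *)

Lemma chi_box_rounding (R : realType) (A : finType) (N : oriented_matroid A) :
  regular R N ->
  forall (kappa : signed_set A -> int) q (x : {ffun A -> 'I_q.+1}), (0 < q)%N ->
  (forall C, \sum_a chi N C a * (x a)%:Z = kappa C * q%:Z) ->
  exists w : {ffun A -> bool}, (forall C, \sum_a chi N C a * (w a)%:Z = kappa C) /\
    (forall a (b : bool), x a = (b * q)%N :> nat -> w a = b).
Proof.
move=> [m [M [TU repM]]] kappa q x q0 chix.
have qR0 : (q%:R : R) != 0 by rewrite pnatr_eq0 -lt0n.
(* The scaled point lies in the unit cube and satisfies the circuit equations with integral values
   [kappa]. *)
pose r a : R := (x a)%:R / q%:R.
have r01 a : 0 <= r a <= 1.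
  by rewrite divr_ge0 ?ler0n // ler_pdivrMr ?ltr0n // mul1r ler_nat -ltnS ltn_ord.
have [C|w [chiw rw]] := rounding TU repM r01 (kappa := kappa).
  apply: (mulIf qR0); rewrite mulr_suml -[q%:R]/(q%:Z%:~R) -rmorphM /= -chix rmorph_sum /=.
  by apply: eq_bigr => a _; rewrite -mulrA divfK // rmorphM.
exists w; split=> // a b xa; apply: rw.
by rewrite /r xa natrM mulfK.
Qed.

Theorem theorem3p2 (R : realType) (A : finType) (N : oriented_matroid A) :
  regular R N ->
  exists! P : {mpoly rat[3]}, forall q : nat, (0 < q)%N -> odd q ->
    specialize_q P q =
      \sum_(f in coflows N q) Yvar ^+ #|fgt f| * Zvar ^+ #|flt f|.
Proof.
move=> regN.
have coeffE q s : specialize_q (cell_coeff s) q = cell_coeff s.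
  case: s => -[] [] /=; rewrite ?specialize_qY ?specialize_qZ // /specialize_q.
    by rewrite rmorphN /= -/(specialize_q _ _) specialize_qZ.
  by rewrite rmorphB rmorph1 /= -/(specialize_q _ _) specialize_qY.
(* The index sets and the cell coefficients are free of [q]; only the box counts vary. *)
have [P HP] : odd_poly_fun (fun q => \sum_(k : {ffun signed_set A -> 'I_#|A|.*2.+1})
    \sum_(t : {ffun A -> bool * bool}) (\prod_a cell_coeff (t a)) *
    (#|box (chi N) q (shifted k) [ffun a => (t a).1]
           [ffun a => if (t a).2 then Some (t a).1 else None]|%:R : rat)%:MP).
  apply: odd_poly_fun_sum => k; apply: odd_poly_fun_sum => t.
  apply: odd_poly_funM; last first.
    apply: odd_poly_fun_quasi_poly; apply: box_quasi_poly.
    exact: chi_box_rounding regN.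
  apply: odd_poly_fun_const => q; rewrite /specialize_q rmorph_prod /=.
  by apply: eq_bigr => a _; exact: coeffE.
have PE q : (0 < q)%N -> odd q -> specialize_q P q =
    \sum_(f in coflows N q) Yvar ^+ #|fgt f| * Zvar ^+ #|flt f|.
  by case: q => // n _ on; rewrite HP // coflow_sum_double // coflow_sum_box.
exists P; split=> // Q HQ; apply/eqP; rewrite -subr_eq0; apply/eqP.
apply: specialize_q_eq0 => q oq; rewrite /specialize_q rmorphB /= -!/(specialize_q _ _).
by rewrite PE ?HQ ?odd_gt0 // subrr.
Qed.
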